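(* For every integer $n\ge 2$ there exist rational numbers $b_{k,n}$ ($0\le k\le n$), independent of $q$, such that for every odd prime power $q$ $$B_q(n)=\sum_{k=0}^{n} b_{k,n}\,q^{n-k}.$$ Moreover: (a) there are rational numbers $\delta_{k,j,n}$ ($k\le j\le 2k$), independent of $q$, such that $$b_{k,n}=\sum_{j=k}^{2k}\delta_{k,j,n}\,h_{n-j};$$ (b) $\delta_{k,j,n}=\delta_{k,j,n+1}$ whenever $n\ge 2k$, and there is an absolute constant $C$ such that $|\delta_{k,j,n}|\le C\,(1.1)^k$ for all $k,j,n$.
   Context: For an odd prime power $q$, let $\mathcal{M}_{n,q}$ be the set of monic polynomials of degree $n$ in $\mathbb{F}_q[T]$. For $f\in\mathcal{M}_{n,q}$ put $b_q(f)=1$ if $f=A^2+TB^2$ for some $A,B\in\mathbb{F}_q[T]$, and $b_q(f)=0$ otherwise; set $B_q(n)=\sum_{f\in\mathcal{M}_{n,q}}b_q(f)$. For an integer $m\ge 0$ let $h_m=\binom{2m}{m}/4^m$, and set $h_m=0$ for $m<0$. *)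

(* Defs.v *)
From HB Require Import structures.
From mathcomp Require Import all_boot all_order all_algebra all_field.
From Stdlib Require Import ClassicalEpsilon.
Set Implicit Arguments. Unset Strict Implicit. Unset Printing Implicit Defensive.
Import Order.TTheory GRing.Theory Num.Theory.
Local Open Scope ring_scope.

Definition sum_form (F : finFieldType) (f : {poly F}) : Prop :=
  exists A B : {poly F}, f = A ^+ 2 + 'X * B ^+ 2.

Definition bq (F : finFieldType) (f : {poly F}) : nat :=
  if excluded_middle_informative (sum_form f) then 1%N else 0%N.

(* The monic polynomial of degree n with lower coefficients t:
   t_0 + t_1 T + ... + t_{n-1} T^{n-1} + T^n. This is a bijection
   between n.-tuples over F and monic polynomials of degree n. *)
Definition monic_of (F : finFieldType) (n : nat) (t : n.-tuple F) : {poly F} :=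
  Poly (rcons (tval t) 1).

Definition Bq (F : finFieldType) (n : nat) : nat :=
  (\sum_(t : n.-tuple F) bq (monic_of t))%N.

Definition hh (m : int) : rat :=
  match m with
  | Posz k => ('C(2 * k, k))%:R / (4 ^ k)%:R
  | Negz _ => 0
  end.

(* Main.v *)
Require Import Defs.
From HB Require Import structures.
From mathcomp Require Import all_boot all_order all_algebra all_field.
From mathcomp Require Import fingroup cyclic boolp ring lra zify.
Set Implicit Arguments. Unset Strict Implicit. Unset Printing Implicit Defensive.
Import Order.TTheory GRing.Theory Num.Theory.
Local Open Scope ring_scope.

(**
With T = -S^2, the polynomials A^2 + T B^2 are the norms g(S) g(-S) from F_q[S].
Up to sign, g |-> g(-S) permutes the monic primes of F_q[S]; choose one prime
from each pair of distinct conjugates. Let a range over products of chosen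
primes, w over products of self-conjugate primes, and y over products a w.
Monic polynomials are uniquely conj(a) y, norms correspond bijectively to
the y, and monic even polynomials are uniquely a conj(a) w with w of even degree.
Since S is self-conjugate, w of odd degree 2m+1 are S times those of degree 2m.
The generating functions A, W, B of a, w, y therefore satisfy
    1 / (1 - qu) = A B,   B = A W,   W(u) = (1 + u) B(u^2),
whence (1 - qu) B(u)^2 = (1 + u) B(u^2).

Let P = (1 - qu)^(-1/2), with coefficients h_m q^m, and B = P G. Then
D = u G'/G satisfies
    D(u) = u / (2 (1 + u)) + q u^2 / (2 (1 - q u^2)) + D(u^2),
so the coefficient G_n is a polynomial in q of degree at most n/2, independent
of the field, and delta_{k,j,n} is the coefficient of q^(j-k) in G_j. In the norm
sum_i |p_i| (11/10)^i the D_n are O(n (21/20)^n), and n G_n = sum_k D_k G_{n-k}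
gives ||G_n|| = O((11/10)^n), which is the uniform bound.
*)

(** * Formal power series *)

Definition fps (R : comNzRingType) : Type := nat -> R.

Section PowerSeries.
Variable R : comNzRingType.
Implicit Types f g h : fps R.

HB.instance Definition _ := gen_eqMixin (fps R).
HB.instance Definition _ := gen_choiceMixin (fps R).

Definition fps_add f g : fps R := fun n => f n + g n.
Definition fps_opp f : fps R := fun n => - f n.
Definition fps_const (c : R) : fps R := fun n => if n == 0%N then c else 0.
Definition fps_mul f g : fps R := fun n => \sum_(i < n.+1) f i * g (n - i)%N.

Lemma fpsP f g : f =1 g -> f = g. Proof. exact: funext. Qed.

Lemma fps_addA : associative fps_add.
Proof. by move=> f g h; apply: fpsP => n; rewrite /fps_add addrA. Qed.
Lemma fps_addC : commutative fps_add.
Proof. by move=> f g; apply: fpsP => n; rewrite /fps_add addrC. Qed.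
Lemma fps_add0 : left_id (fps_const 0) fps_add.
Proof.
by move=> f; apply: fpsP => n; rewrite /fps_add /fps_const if_same add0r.
Qed.
Lemma fps_addN : left_inverse (fps_const 0) fps_opp fps_add.
Proof.
move=> f; apply: fpsP => n.
by rewrite /fps_add /fps_opp /fps_const if_same addNr.
Qed.

HB.instance Definition _ :=
  GRing.isZmodule.Build (fps R) fps_addA fps_addC fps_add0 fps_addN.

(* Up to any order the product is a product of truncations, which transports
   the ring laws from polynomials. *)
Definition fps_trunc N f : {poly R} := \poly_(i < N) f i.

Lemma coefM_eq (p p' q q' : {poly R}) n :
    (forall i, (i <= n)%N -> p`_i = p'`_i) ->
    (forall i, (i <= n)%N -> q`_i = q'`_i) ->
  (p * q)`_n = (p' * q')`_n.
Proof.
move=> Hp Hq; rewrite !coefM; apply: eq_bigr => i _.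
by rewrite Hp ?Hq ?leq_subr // -ltnS.
Qed.

Lemma coef_fps_truncM N f g n :
  (n < N)%N -> (fps_trunc N f * fps_trunc N g)`_n = fps_mul f g n.
Proof.
move=> ltnN; rewrite coefM; apply: eq_bigr => i _; rewrite !coef_poly.
by rewrite (leq_ltn_trans (leq_subr _ _) ltnN) (leq_ltn_trans _ ltnN) -1?ltnS.
Qed.

Lemma fps_mulA : associative fps_mul.
Proof.
move=> f g h; apply: fpsP => n; rewrite -!(@coef_fps_truncM n.+1) //.
have E f1 g1 i : (i <= n)%N -> (fps_trunc n.+1 (fps_mul f1 g1))`_i =
    (fps_trunc n.+1 f1 * fps_trunc n.+1 g1)`_i.
  by move=> lin; rewrite coef_poly ltnS lin coef_fps_truncM ?ltnS.
rewrite (coefM_eq (n := n) (fun=> fun=> erefl) (E g h)) mulrA.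
by apply: coefM_eq => // i lin; rewrite E.
Qed.
Lemma fps_mulC : commutative fps_mul.
Proof.
by move=> f g; apply: fpsP => n; rewrite -!(@coef_fps_truncM n.+1) // mulrC.
Qed.
Lemma fps_mul1 : left_id (fps_const 1) fps_mul.
Proof.
move=> f; apply: fpsP => n; rewrite /fps_mul big_ord_recl /= subn0 mul1r.
by rewrite big1 ?addr0 // => i _; rewrite /fps_const /= mul0r.
Qed.
Lemma fps_mulD : left_distributive fps_mul fps_add.
Proof.
move=> f g h; apply: fpsP => n; rewrite /fps_mul /fps_add -big_split /=.
by apply: eq_bigr => i _; rewrite mulrDl.
Qed.
Lemma fps_1_neq0 : fps_const 1 != 0.
Proof. by apply/eqP => /(congr1 (@^~ 0%N))/eqP; rewrite oner_eq0. Qed.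

HB.instance Definition _ := GRing.Zmodule_isComNzRing.Build (fps R)
  fps_mulA fps_mulC fps_mul1 fps_mulD fps_1_neq0.

Lemma fpsDE f g n : (f + g) n = f n + g n. Proof. by []. Qed.
Lemma fpsNE f n : (- f) n = - f n. Proof. by []. Qed.
Lemma fpsME f g n : (f * g) n = \sum_(i < n.+1) f i * g (n - i)%N.
Proof. by []. Qed.
Lemma fps0E n : (0 : fps R) n = 0. Proof. exact: if_same. Qed.
Lemma fps1E n : (1 : fps R) n = (n == 0%N)%:R. Proof. by case: n. Qed.
Lemma fpsM0E f g : (f * g) 0%N = f 0%N * g 0%N.
Proof. by rewrite fpsME big_ord1. Qed.

Definition fpsX : fps R := fun n => (n == 1%N)%:R.

Lemma fpsXM0 f : (fpsX * f) 0%N = 0.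
Proof. by rewrite fpsM0E mul0r. Qed.
Lemma fpsXMS f n : (fpsX * f) n.+1 = f n.
Proof.
rewrite fpsME big_ord_recl mul0r add0r big_ord_recl mul1r /= subSS subn0.
by rewrite big1 ?addr0 // => i _; rewrite /fpsX /= mul0r.
Qed.

Lemma fps_const_mulE c f n : (fps_const c * f) n = c * f n.
Proof.
rewrite fpsME big_ord_recl subn0 big1 ?addr0 // => i _.
by rewrite /fps_const /= mul0r.
Qed.

(** The derivation u d/du; it keeps degrees in place, so [theta B = E * B] says that E is the
    logarithmic derivative uB'/B. *)
Definition theta f : fps R := fun n => n%:R * f n.

Lemma thetaM f g : theta (f * g) = theta f * g + f * theta g.
Proof.
apply: fpsP => n; rewrite fpsDE /theta !fpsME big_distrr -big_split /=.
apply: eq_bigr => i _.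
have -> : n%:R = i%:R + (n - i)%:R :> R by rewrite -natrD subnKC -1?ltnS.
ring.
Qed.

Lemma thetaD f g : theta (f + g) = theta f + theta g.
Proof. by apply: fpsP => n; rewrite /theta fpsDE mulrDr. Qed.

(** The substitution f(u^2). *)
Definition fps_sq f : fps R := fun n => if odd n then 0 else f n./2.

Lemma fps_trunc_sq N f :
  fps_trunc N.*2 (fps_sq f) = fps_trunc N f \Po 'X^2.
Proof.
apply/polyP => i; rewrite coef_comp_poly_Xn // !coef_poly /fps_sq dvdn2 divn2.
have [oi|ei] := boolP (odd i); first by rewrite if_same.
by have -> : (i < N.*2)%N = (i./2 < N)%N by lia.
Qed.

Lemma fps_sqM f g : fps_sq (f * g) = fps_sq f * fps_sq g.
Proof.
apply: fpsP => n; rewrite -[RHS]/(fps_mul _ _ n).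
rewrite -(@coef_fps_truncM n.+1.*2) ?fps_trunc_sq; last lia.
rewrite -rmorphM /= coef_comp_poly_Xn // dvdn2 divn2 /fps_sq; case: ifP => //= _.
by rewrite coef_fps_truncM //; lia.
Qed.

Lemma fps_sqD f g : fps_sq (f + g) = fps_sq f + fps_sq g.
Proof.
by apply: fpsP => n; rewrite fpsDE /fps_sq; case: ifP; rewrite ?addr0.
Qed.

Lemma fps_sqN f : fps_sq (- f) = - fps_sq f.
Proof. by apply: fpsP => n; rewrite fpsNE /fps_sq; case: ifP; rewrite ?oppr0. Qed.

Lemma theta_sq f : theta (fps_sq f) = (fps_sq (theta f)) *+ 2.
Proof.
apply: fpsP => n; rewrite mulr2n fpsDE /theta /fps_sq.
case: ifP => on; first by rewrite mulr0 addr0.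
rewrite -mulrDl -natrD addnn; congr (_%:R * _); lia.
Qed.

End PowerSeries.

(** * The logarithmic derivative of a solution of (1 - qu) B(u)^2 = (1 + u) B(u^2) *)

(** The iterate [it m] is already correct at every index below m, because [Phi] consults only
    smaller indices; the diagonal of the iterates is the solution. *)
Lemma strong_rec (T : Type) (x0 : T) (Phi : nat -> (nat -> T) -> T) :
    (forall n f g, (forall i, (i < n)%N -> f i = g i) -> Phi n f = Phi n g) ->
  exists f, forall n, f n = Phi n f.
Proof.
move=> ext; pose it := fix it m := if m is m'.+1 then Phi^~ (it m') else fun=> x0.
have itE m m' n : (n < m)%N -> (n < m')%N -> it m n = it m' n.
  elim: m m' n => [//|m IH] [//|m'] n /= ltnm ltnm'.
  by apply: ext => i ltin; apply: IH; lia.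
exists (fun n => it n.+1 n) => n /=.
by apply: ext => i ltin; exact: (itE n i.+1 i ltin (ltnSn i)).
Qed.

(** As E has no constant term, coefficient n+1 of [E * h] involves only lower coefficients of h,
    while the left side is (n+1) h_{n+1}. *)
Lemma fps_theta_eq0 (E h : fps rat) :
  E 0%N = 0 -> theta h = E * h -> h 0%N = 0 -> h = 0.
Proof.
move=> E0 hE h0; apply: fpsP => n; rewrite fps0E.
elim/ltn_ind: n => -[//|n] IH.
have := congr1 (@^~ n.+1) hE; rewrite fpsME big_ord_recl E0 mul0r add0r /theta.
rewrite big1 => [/eqP|i _]; first by rewrite mulf_eq0 pnatr_eq0 => /eqP.
by rewrite IH ?mulr0 // /= /bump; lia.
Qed.

Lemma fps_mulIl (A f : fps rat) : A 0%N = 1 -> A * f = 0 -> f = 0.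
Proof.
move=> A0 Af; apply: fpsP => n; rewrite fps0E.
elim/ltn_ind: n => n IH.
have := congr1 (@^~ n) Af; rewrite fpsME big_ord_recl A0 mul1r subn0 fps0E.
by rewrite big1 ?addr0 // => i _; rewrite IH ?mulr0 // /= /bump; case: i => i /= ?; lia.
Qed.

Section LogDerivative.
Variable q : rat.
Let X := fpsX rat.
Let c (a : rat) := fps_const a : fps rat.

Lemma fps_one_minus0 f : ((1 - c q * X) * f) 0%N = f 0%N.
Proof.
rewrite mulrBl mul1r fpsDE fpsNE -mulrA fps_const_mulE fpsXM0.
by rewrite mulr0 subr0.
Qed.
Lemma fps_one_minusS f n : ((1 - c q * X) * f) n.+1 = f n.+1 - q * f n.
Proof.
by rewrite mulrBl mul1r fpsDE fpsNE -mulrA fps_const_mulE fpsXMS.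
Qed.

Variables B E : fps rat.
Hypothesis B0 : B 0%N = 1.
Hypothesis Bsq : (1 - c q * X) * B ^+ 2 = (1 + X) * fps_sq B.
Hypothesis E0 : E 0%N = 0.
Hypothesis EE : forall n, E n.+1 =
  q ^+ n.+1 / 2%:R + (-1) ^+ n / 2%:R + fps_sq E n.+1.

(** The hypothesis on E reads 2E = qu/(1 - qu) + u/(1 + u) + 2E(u^2), which is what logarithmic
    differentiation of [Bsq] predicts for uB'/B. The two fractions are Q and A below. *)
Lemma fps_log_derivative : theta B = E * B.
Proof.
pose Q : fps rat := fun n => if n is _.+1 then q ^+ n else 0.
pose A : fps rat := fun n => if n is m.+1 then (-1) ^+ m else 0.
have QE : (1 - c q * X) * Q = c q * X.
  apply: fpsP => -[|n]; first by rewrite fps_one_minus0 fps_const_mulE mulr0.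
  rewrite fps_one_minusS fps_const_mulE /X /fpsX; case: n => [|n] /=.
    by rewrite expr1 mulr0 subr0 mulr1.
  by rewrite exprS subrr mulr0.
have AE : (1 + X) * A = X.
  apply: fpsP => -[|n]; first by rewrite mulrDl mul1r fpsDE fpsXM0 addr0.
  rewrite mulrDl mul1r fpsDE fpsXMS /X /fpsX; case: n => [|n] /=.
    by rewrite addr0.
  by rewrite exprS mulN1r addNr.
have E2 : E + E = Q + A + (fps_sq E + fps_sq E).
  apply: fpsP => -[|n]; rewrite !fpsDE /=.
    by rewrite /fps_sq /= E0 !addr0.
  by rewrite EE; field.
have tX : theta X = X.
  by apply: fpsP => -[|[|n]]; rewrite /theta /X /fpsX /= ?mulr0 ?mulr1.
have tqX : theta (1 - c q * X) = - (c q * X).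
  apply: fpsP => n; rewrite /theta fpsDE !fpsNE fps1E !fps_const_mulE /X /fpsX.
  by case: n => [|[|n]] /=; rewrite ?mulr0 ?mulr1 ?sub0r ?mul1r ?mul0r ?oppr0 ?mulr0.
have tX1 : theta (1 + X) = X.
  rewrite thetaD tX; apply: fpsP => n; rewrite fpsDE /theta fps1E.
  by case: n => [|n] /=; rewrite ?mul0r ?mulr0 add0r.
(* The defect [Y = theta B - E B] satisfies [B Y (1 - qu) = (1 + u) Y(u^2)],
   and the lowest nonzero coefficient of [Y] would contradict this. *)
pose Y := theta B - E * B.
have tBsq : - (c q * X) * B ^+ 2 + (1 - c q * X) * (B * theta B *+ 2) =
    X * fps_sq B + (1 + X) * (fps_sq (theta B) *+ 2).
  have := congr1 (@theta _) Bsq.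
  rewrite expr2 !thetaM tqX tX1 theta_sq => <-; ring.
have Ysq : B * Y * (1 - c q * X) *+ 2 = (1 + X) * fps_sq Y *+ 2.
  have -> : B * Y * (1 - c q * X) *+ 2 =
     (1 - c q * X) * (B * theta B *+ 2) - (E + E) * ((1 - c q * X) * B ^+ 2).
    by rewrite /Y; ring.
  have -> : (1 - c q * X) * (B * theta B *+ 2) =
      X * fps_sq B + (1 + X) * (fps_sq (theta B) *+ 2) + (c q * X) * B ^+ 2.
    by rewrite -tBsq; ring.
  have -> : (E + E) * ((1 - c q * X) * B ^+ 2) = (c q * X) * B ^+ 2
     + X * fps_sq B + (fps_sq E *+ 2) * ((1 + X) * fps_sq B).
    rewrite E2.
    have -> : (Q + A + (fps_sq E + fps_sq E)) * ((1 - c q * X) * B ^+ 2) =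
      (1 - c q * X) * Q * B ^+ 2 + A * ((1 - c q * X) * B ^+ 2) +
      (fps_sq E *+ 2) * ((1 - c q * X) * B ^+ 2) by ring.
    rewrite QE Bsq.
    have <- : (1 + X) * A * fps_sq B = X * fps_sq B by rewrite AE.
    ring.
  rewrite /Y fps_sqD fps_sqN fps_sqM; ring.
suff Y0 : Y = 0 by move/eqP: Y0; rewrite subr_eq0 => /eqP.
apply: fpsP => n; rewrite fps0E; elim/ltn_ind: n => n IH.
have lowBY i : (i < n)%N -> (B * Y) i = 0.
  move=> lin; rewrite fpsME big1 // => j _; rewrite IH ?mulr0 //.
  exact: leq_ltn_trans (leq_subr _ _) lin.
have BYn : (B * Y) n = Y n.
  rewrite fpsME big_ord_recl B0 mul1r subn0 big1 ?addr0 // => i _.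
  by rewrite IH ?mulr0 // /= /bump; case: i => i /= ?; lia.
have := congr1 (@^~ n) Ysq.
rewrite [_ * (1 - _)]mulrC mulr2n (mulr2n ((1 + X) * _)) !fpsDE.
rewrite [(1 + X) * _]mulrDl mul1r fpsDE.
(* Coefficient m of Y(u^2) is zero or Y at m/2, an index below n unless m = n = 0. *)
have sqY m : (0 < m)%N || (m < n)%N -> (m <= n)%N -> fps_sq Y m = 0.
  move=> mn lmn; rewrite /fps_sq; case: ifP => // _; apply: IH; lia.
case: n {IH} => [|n] in lowBY BYn sqY *.
  (* At n = 0 the comparison is vacuous; Y_0 vanishes because [theta B] and E have no constant
     term. *)
  move=> _; rewrite /Y fpsDE fpsNE.
  by rewrite {1}/theta mul0r !fpsM0E E0 mul0r subr0.
rewrite fpsXMS fps_one_minusS BYn lowBY // (sqY n.+1) // (sqY n) ?ltnSn ?orbT //.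
lra.
Qed.

End LogDerivative.

(** * Unique factorisation along classes of primes *)

Section SmoothParts.
Variable F : fieldType.
Implicit Types (a b g p Q : {poly F}) (C D : {poly F} -> Prop).

Definition monic_irr Q : Prop := irreducible_poly Q /\ Q \is monic.

Lemma monic_irr_dvd_ex p : (1 < size p)%N -> exists2 Q, monic_irr Q & Q %| p.
Proof.
have [n] := ubnP (size p); elim: n p => // n IH p ltpn p1.
have [irr|nirr] := pselect (irreducible_poly p).
  exists ((lead_coef p)^-1 *: p); last first.
    by rewrite dvdpZl // invr_eq0 lead_coef_eq0 -size_poly_eq0; case: size p1.
  have lc0 : (lead_coef p)^-1 != 0.
    by rewrite invr_eq0 lead_coef_eq0 -size_poly_eq0; case: size p1.
  split; last by rewrite monicE lead_coefZ mulVf -1?invr_eq0.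
  split=> [|q q1]; first by rewrite size_scale.
  rewrite dvdpZr // => /irr; rewrite (eqp_rtrans (eqp_scale _ lc0)); exact.
have [q [q1 qp nqp]] : exists q : {poly F}, [/\ size q != 1%N, q %| p & ~~ (q %= p)].
  apply: contrapT => H; apply: nirr; split=> // q q1 qp.
  by apply: contrapT => /negP nqp; apply: H; exists q.
have p0 : p != 0 by rewrite -size_poly_eq0; case: size p1.
have q0 : q != 0 by apply: contraNneq p0 => q0; rewrite q0 dvd0p in qp.
have ltqp : (size q < size p)%N.
  by rewrite ltn_neqAle (dvdp_leq p0 qp) andbT; rewrite -(dvdp_size_eqp qp) in nqp.
have [||Q irrQ Qq] := IH q; first exact: leq_trans ltqp _.
  by rewrite ltn_neqAle eq_sym q1 size_poly_gt0.
by exists Q => //; apply: dvdp_trans qp.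
Qed.

Lemma monic_irr_dvd_eq Q Q' : monic_irr Q -> monic_irr Q' -> Q %| Q' -> Q = Q'.
Proof.
move=> [[Q1 irrQ] mQ] [[Q'1 irrQ'] mQ'] QQ'; apply/eqP.
by rewrite -eqp_monic // irrQ' //; case: size Q1 => [|[]].
Qed.

Lemma monic_irr_dvdM Q a b : monic_irr Q -> Q %| a * b -> Q %| a \/ Q %| b.
Proof.
move=> [[Q1 irrQ] mQ]; have [Qa|nQa] := boolP (Q %| a); first by left.
rewrite Gauss_dvdpr => [|]; first by right.
rewrite /coprimep; apply: contraNT nQa => g1.
by rewrite -(eqp_dvdl _ (irrQ _ g1 (dvdp_gcdl _ _))) dvdp_gcdr.
Qed.

(** The multiplicative monoid generated by the primes in C. Stating it through prime divisors avoids
    lists of factors. *)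
Definition smooth C g : Prop :=
  g \is monic /\ forall Q, monic_irr Q -> Q %| g -> C Q.

Lemma smooth_monic C g : smooth C g -> g \is monic. Proof. by case. Qed.

Lemma smooth1 C : smooth C 1.
Proof.
split=> [|Q [[Q1 _] _]]; first exact: monic1.
by rewrite dvdp1 => /eqP Q1'; rewrite Q1' in Q1.
Qed.

Lemma smoothM C a b : smooth C a -> smooth C b -> smooth C (a * b).
Proof.
move=> [ma Ca] [mb Cb]; split; first by rewrite monicMl.
by move=> Q irrQ /(monic_irr_dvdM irrQ)[]; [apply: Ca|apply: Cb].
Qed.

Lemma smooth_dvd C a g : a \is monic -> a %| g -> smooth C g -> smooth C a.
Proof.
by move=> ma ag [mg Cg]; split=> // Q irrQ Qa; apply: Cg (dvdp_trans Qa ag).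
Qed.

Lemma smooth_imp C D g : (forall Q, C Q -> D Q) -> smooth C g -> smooth D g.
Proof. by move=> CD [mg Cg]; split=> // Q irrQ Qg; apply/CD/Cg. Qed.

Lemma smooth_irr C Q : monic_irr Q -> C Q -> smooth C Q.
Proof.
move=> irrQ CQ; split=> [|Q' irrQ' /(monic_irr_dvd_eq irrQ' irrQ) -> //].
by case: irrQ.
Qed.

Lemma smooth_ind C (P : {poly F} -> Prop) : P 1 ->
    (forall Q g, monic_irr Q -> C Q -> smooth C g -> P g -> P (Q * g)) ->
  forall g, smooth C g -> P g.
Proof.
move=> P1 PM g; have [n] := ubnP (size g); elim: n g => // n IH g ltgn Cg.
have mg := smooth_monic Cg.
have [g1|g1] := leqP (size g) 1.
  by rewrite (size1_polyC g1) in mg *; move: mg; rewrite monicE lead_coefC => /eqP->.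
have [Q irrQ Qg] := monic_irr_dvd_ex g1.
have mQ : Q \is monic by case: irrQ.
have gE : g = Q * (g %/ Q) by rewrite mulrC divpK.
have mgQ : g %/ Q \is monic by rewrite -(monicMr _ mQ) divpK.
have CgQ : smooth C (g %/ Q) by apply: smooth_dvd Cg; rewrite ?divp_dvd.
rewrite gE; apply: PM => //; first by case: Cg => _; apply.
apply: IH => //; rewrite -ltnS; apply: leq_trans ltgn; rewrite ltnS.
have -> : size g = size (Q * (g %/ Q)) by rewrite -gE.
rewrite size_monicM ?monic_neq0 //; case: irrQ => -[Q1 _] _.
by case: (size Q) Q1 => [|[|k]] // _; rewrite !addSn /= ltnS leq_addl.
Qed.

Lemma smooth_split C D g : smooth (fun Q => C Q \/ D Q) g ->
  exists a b, [/\ smooth C a, smooth D b & g = a * b].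
Proof.
move: g; apply: smooth_ind.
  by exists 1, 1; rewrite mulr1; split=> //; apply: smooth1.
move=> Q g irrQ [] hQ _ [a [b [Ca Db ->]]].
  exists (Q * a), b; rewrite mulrA; split=> //; apply: smoothM => //.
  exact: smooth_irr.
exists a, (Q * b); rewrite mulrCA; split=> //; apply: smoothM => //.
exact: smooth_irr.
Qed.

Lemma smooth_coprime C D a b : (forall Q, C Q -> D Q -> False) ->
  smooth C a -> smooth D b -> coprimep a b.
Proof.
move=> CD [ma Ca] [mb Db]; rewrite /coprimep.
have [g1|] := leqP (size (gcdp a b)) 1.
  by rewrite eqn_leq g1 size_poly_gt0 gcdp_eq0 negb_and monic_neq0.
move=> /monic_irr_dvd_ex[Q irrQ]; rewrite dvdp_gcd => /andP[Qa Qb].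
by case: (CD Q); [apply: Ca|apply: Db].
Qed.

(** By coprimality, a divides a' * b' and is prime to b', so it divides a'; symmetrically a' divides
    a, and monic associates are equal. *)
Lemma smooth_inj C D a b a' b' : (forall Q, C Q -> D Q -> False) ->
    smooth C a -> smooth D b -> smooth C a' -> smooth D b' ->
  a * b = a' * b' -> a = a' /\ b = b'.
Proof.
move=> CD Ca Db Ca' Db' E.
have eqa : a = a'.
  apply/eqP; rewrite -eqp_monic ?(smooth_monic Ca) ?(smooth_monic Ca') //.
  rewrite /eqp -(Gauss_dvdpl a' (smooth_coprime CD Ca Db')) -E dvdp_mulr //=.
  by rewrite -(Gauss_dvdpl a (smooth_coprime CD Ca' Db)) E dvdp_mulr.
split=> //; move: E; rewrite eqa; apply: mulfI.
exact/monic_neq0/(smooth_monic Ca').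
Qed.

Lemma deg_monicM a b : a \is monic -> b \is monic ->
  (size (a * b)).-1 = ((size a).-1 + (size b).-1)%N.
Proof.
move=> ma mb; rewrite size_monicM ?monic_neq0 //.
by rewrite (polySpred (monic_neq0 ma)) (polySpred (monic_neq0 mb)) addnS.
Qed.

End SmoothParts.

(** Combinatorial form of a product of generating functions: [m] matches pairs of total degree n
    with [D n]. Disjoint degrees in A keep the pairs for different i apart. *)
Lemma size_convolution (T1 T2 T3 : eqType) (A : nat -> seq T1)
    (B : nat -> seq T2) (D : nat -> seq T3) (m : T1 -> T2 -> T3) :
    (forall i, uniq (A i)) -> (forall i, uniq (B i)) -> (forall i, uniq (D i)) ->
    (forall i j a, a \in A i -> a \in A j -> i = j) ->
    (forall i j a b, a \in A i -> b \in B j -> m a b \in D (i + j)%N) ->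
    (forall i j i' j' a b a' b', a \in A i -> b \in B j -> a' \in A i' ->
       b' \in B j' -> m a b = m a' b' -> a = a' /\ b = b') ->
    (forall n c, c \in D n -> exists i j a b,
       [/\ (i + j)%N = n, a \in A i, b \in B j & c = m a b]) ->
  forall n, size (D n) = (\sum_(i < n.+1) size (A i) * size (B (n - i)%N))%N.
Proof.
move=> uA uB uD dA mD minj msurj n.
pose s := [seq c | i <- iota 0 n.+1, c <- [seq m a b | a <- A i, b <- B (n - i)%N]].
have us : uniq s.
  apply: allpairs_uniq_dep => [|i _|]; first exact: iota_uniq.
    apply: allpairs_uniq => // -[a b] [a' b'] /allpairsP[[? ?] [/= h1 h2 [-> ->]]].
    move=> /allpairsP[[? ?] [/= h3 h4 [-> ->]]] E.
    by have [-> ->] := minj _ _ _ _ _ _ _ _ h1 h2 h3 h4 E.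
  move=> u v /allpairsPdep[i [c [_ hc ->]]] /allpairsPdep[i' [c' [_ hc' ->]]] /= E.
  case/allpairsP: hc E => -[a b] [/= ha hb ->].
  case/allpairsP: hc' => -[a' b'] [/= ha' hb' ->] E.
  have [eqa eqb] := minj _ _ _ _ _ _ _ _ ha hb ha' hb' E.
  by rewrite -eqa in ha' *; rewrite -(dA _ _ _ ha ha') eqb.
have -> : size (D n) = size s.
  apply/perm_size/uniq_perm => // c; apply/idP/allpairsPdep.
    move=> /msurj[i [j [a [b [<- ha hb ->]]]]]; exists i, (m a b).
    split=> //; first by rewrite mem_iota; lia.
    by apply/allpairsP; exists (a, b); split=> //; rewrite addKn.
  move=> [i [_ [+ /allpairsP[[a b] [/= ha hb ->]] ->]]]; rewrite mem_iota => lin.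
  by have := mD _ _ _ _ ha hb; rewrite subnKC //; lia.
rewrite size_allpairs_dep sumnE big_map -[iota _ _]/(index_iota 0 n.+1) big_mkord.
by apply: eq_bigr => i _; rewrite size_allpairs.
Qed.

(** * Conjugation, norms and counting *)

Section Conjugation.
Variable F : fieldType.
Implicit Types (a b g p Q : {poly F}).

(* Substituting [T = -S^2] identifies [sqrt(-T)] with [S]; this is the
   nontrivial automorphism of [F(S)] over [F(T)], normalised to preserve
   monic polynomials. *)
Definition conj p : {poly F} := (-1) ^+ (size p).-1 *: (p \Po - 'X).

Lemma size_oppX : size (- 'X : {poly F}) = 2.
Proof. by rewrite size_polyN size_polyX. Qed.

Lemma comp_oppXK p : (p \Po - 'X) \Po - 'X = p.
Proof. by rewrite -comp_polyA rmorphN /= comp_polyX opprK comp_polyXr. Qed.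

Lemma size_conj p : size (conj p) = size p.
Proof. by rewrite size_scale ?signr_eq0 // size_comp_poly2 // size_oppX. Qed.

Lemma comp_oppX_conj p : p \Po - 'X = (-1) ^+ (size p).-1 *: conj p.
Proof. by rewrite scalerA -expr2 sqrr_sign scale1r. Qed.

Lemma conjK p : conj (conj p) = p.
Proof.
by rewrite {1}/conj size_conj comp_polyZ comp_oppXK scalerA -expr2 sqrr_sign scale1r.
Qed.

Lemma conj_monic p : p \is monic -> conj p \is monic.
Proof.
move=> mp; rewrite monicE lead_coefZ lead_coef_comp ?size_oppX // (monicP mp).
by rewrite lead_coefN lead_coefX mul1r -expr2 sqrr_sign.
Qed.

Lemma conjM a b : a \is monic -> b \is monic -> conj (a * b) = conj a * conj b.
Proof.
move=> ma mb; rewrite /conj deg_monicM // exprD comp_polyM.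
by rewrite -scalerAl -scalerAr scalerA.
Qed.

Lemma conj1 : conj 1 = 1.
Proof. by rewrite /conj size_poly1 scale1r comp_polyC. Qed.

Lemma conjX : conj 'X = 'X.
Proof. by rewrite /conj size_polyX comp_polyX scaleN1r opprK. Qed.

Lemma conj_dvd a b : a %| b -> conj a %| conj b.
Proof.
by move=> ab; rewrite dvdpZl ?dvdpZr ?signr_eq0 //; apply: dvdp_comp_poly.
Qed.

Lemma conj_irr Q : monic_irr Q -> monic_irr (conj Q).
Proof.
move=> [[Q1 irrQ] mQ]; split; last exact: conj_monic.
split=> [|d d1 dQ]; first by rewrite size_conj.
have /irrQ : size (conj d) != 1 by rewrite size_conj.
have := conj_dvd dQ; rewrite conjK => dQ' /(_ dQ') /andP[_ Qd].
by rewrite /eqp dQ -[d]conjK conj_dvd.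
Qed.

Lemma smooth_conj (C : {poly F} -> Prop) g :
  smooth C g -> smooth (fun Q => C (conj Q)) (conj g).
Proof.
move=> [mg Cg]; split=> [|Q irrQ Qg]; first exact: conj_monic.
by apply: Cg; [apply: conj_irr|rewrite -[g]conjK conj_dvd].
Qed.

Lemma smooth_fixed w : smooth (fun Q => conj Q = Q) w -> conj w = w.
Proof.
move: w; apply: smooth_ind => [|Q g [_ mQ] fQ Cg fg]; first exact: conj1.
by rewrite conjM ?fQ ?fg //; apply: smooth_monic Cg.
Qed.

Lemma comp_oppX_even_odd p :
  p \Po - 'X = even_poly p \Po 'X^2 - (odd_poly p \Po 'X^2) * 'X.
Proof.
rewrite -{1}[p]poly_even_odd comp_polyD comp_polyM -!comp_polyA comp_polyX.
by rewrite comp_Xn_poly sqrrN mulrN.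
Qed.

(** The norm from F[S] to F[T] with S^2 = -T: e(S^2) + S o(S^2) goes to e(-T)^2 + T o(-T)^2, visibly
    of the shape A^2 + T B^2. *)
Definition half_norm p : {poly F} :=
  (even_poly p \Po - 'X) ^+ 2 + 'X * (odd_poly p \Po - 'X) ^+ 2.

Lemma comp_half_norm p : half_norm p \Po (- 'X^2) = p * (p \Po - 'X).
Proof.
rewrite comp_oppX_even_odd -{2}[p]poly_even_odd /half_norm.
rewrite !expr2 comp_polyD !comp_polyM -!comp_polyA rmorphN /= !comp_polyX -!expr2 opprK.

ring.
Qed.

Lemma size_oppX2 : size (- 'X^2 : {poly F}) = 3.
Proof. by rewrite size_polyN size_polyXn. Qed.

Lemma comp_oppX2_inj : injective (fun p : {poly F} => p \Po - 'X^2).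
Proof.
move=> p q /eqP; rewrite -subr_eq0 -comp_polyB comp_poly_eq0 ?size_oppX2 //.
by rewrite subr_eq0 => /eqP.
Qed.

End Conjugation.

(** * Counting monic polynomials by the classes of their primes *)

Section Counting.
Variable F : finFieldType.
Implicit Types (a b f g p Q w y : {poly F}) (C : {poly F} -> Prop).

Definition monics n : seq {poly F} := [seq monic_of t | t : n.-tuple F].

Lemma monic_of_inj n : injective (@monic_of F n).
Proof.
move=> t u /(congr1 polyseq).
rewrite /monic_of !(@PolyK _ 1) ?last_rcons ?oner_eq0 // => /rcons_inj[].
exact: val_inj.
Qed.

Lemma monics_uniq n : uniq (monics n).
Proof. by rewrite map_inj_uniq ?enum_uniq //; apply: monic_of_inj. Qed.

Lemma size_monics n : size (monics n) = (#|F| ^ n)%N.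
Proof. by rewrite size_map -cardE card_tuple. Qed.

Lemma mem_monics n p : (p \in monics n) = (p \is monic) && ((size p).-1 == n).
Proof.
apply/mapP/andP => [[t _ ->]|[mp /eqP szp]].
  rewrite monicE lead_coefE /monic_of !(@PolyK _ 1) ?last_rcons ?oner_eq0 //.
  by rewrite size_rcons size_tuple /= nth_rcons size_tuple ltnn eqxx.
have p_nil : polyseq p = rcons (take n p) 1.
  rewrite -(monicP mp) lead_coefE szp -take_nth ?take_oversize //.
    by rewrite -szp; case: (size p).
  by rewrite -szp ltn_predL size_poly_gt0 monic_neq0.
have szt : size (take n p) == n.
  have := congr1 size p_nil; rewrite size_rcons => E.
  by rewrite -{2}szp E.
exists (Tuple szt); first by rewrite mem_enum.
by rewrite /monic_of /= -p_nil polyseqK.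
Qed.

Definition smooths C n := [seq p <- monics n | `[< smooth C p >]].

Lemma smooths_uniq C n : uniq (smooths C n).
Proof. by rewrite filter_uniq // monics_uniq. Qed.

Lemma smoothsP C n p :
  reflect (smooth C p /\ (size p).-1 = n) (p \in smooths C n).
Proof.
rewrite mem_filter mem_monics; apply: (iffP and3P) => [[/asboolP ? _ /eqP //]|].
by move=> [Cp <-]; split; [exact/asboolP|apply: smooth_monic Cp|].
Qed.

Definition self_conj Q : Prop := conj Q = Q.
(** [pickle] is an injective numbering of polynomials; a pair of distinct conjugates is represented
    by the member with the smaller code. *)
Definition chosen Q : Prop := (pickle Q < pickle (conj Q))%N.
Definition unchosen Q : Prop := (pickle (conj Q) < pickle Q)%N.
Definition chosen_or_self_conj Q : Prop := chosen Q \/ self_conj Q.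

Lemma chosen_cases Q : unchosen Q \/ chosen_or_self_conj Q.
Proof.
have [|lt|eq] := ltngtP (pickle Q) (pickle (conj Q)).
- by right; left.
- by left.
- by right; right; apply: (pcan_inj pickleK).
Qed.

Lemma unchosen_disj Q : unchosen Q -> chosen_or_self_conj Q -> False.
Proof.
rewrite /unchosen => lt []; rewrite /chosen /self_conj => E.
  by have := ltn_trans lt E; rewrite ltnn.
by rewrite E ltnn in lt.
Qed.

Lemma chosen_disj Q : chosen Q -> unchosen Q \/ self_conj Q -> False.
Proof.
rewrite /chosen => lt []; rewrite /unchosen /self_conj => E.
  by have := ltn_trans lt E; rewrite ltnn.
by rewrite E ltnn in lt.
Qed.

Lemma smooth_conj_chosen a : smooth chosen a -> smooth unchosen (conj a).
Proof.
move=> /smooth_conj; apply: smooth_imp => Q.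
by rewrite /chosen /unchosen conjK.
Qed.

Lemma smooth_conj_unchosen a : smooth unchosen a -> smooth chosen (conj a).
Proof.
move=> /smooth_conj; apply: smooth_imp => Q.
by rewrite /chosen /unchosen conjK.
Qed.

Local Notation A := (smooths chosen).
Local Notation W := (smooths self_conj).
Local Notation Y := (smooths chosen_or_self_conj).

(** The identity 1/(1 - qu) = A B: splitting off the unchosen primes writes a monic polynomial
    uniquely as conj(a) y, and conjugation preserves degree. *)
Lemma monics_convolution n :
  (#|F| ^ n = \sum_(i < n.+1) size (A i) * size (Y (n - i)))%N.
Proof.
rewrite -size_monics.
apply: (size_convolution (m := fun a y => conj a * y)) => //.
- exact: smooths_uniq.
- exact: smooths_uniq.
- exact: monics_uniq.
- by move=> i j a /smoothsP[_ <-] /smoothsP[_ <-].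
- move=> i j a y /smoothsP[/smooth_monic ma <-] /smoothsP[/smooth_monic my <-].
  by rewrite mem_monics monicMl ?deg_monicM ?size_conj ?conj_monic ?my ?eqxx.
- move=> i j i' j' a y a' y' /smoothsP[Ca _] /smoothsP[Cy _].
  move=> /smoothsP[Ca' _] /smoothsP[Cy' _] E.
  have [E1 ->] := smooth_inj unchosen_disj (smooth_conj_chosen Ca) Cy
                    (smooth_conj_chosen Ca') Cy' E.
  by rewrite -[a]conjK E1 conjK.
- move=> k g; rewrite mem_monics => /andP[mg /eqP szg].
  have /smooth_split[b [y [Cb Cy gE]]] :
      smooth (fun Q => unchosen Q \/ chosen_or_self_conj Q) g.
    by split=> // Q _ _; apply: chosen_cases.
  exists (size b).-1, (size y).-1, (conj b), y; split; last by rewrite conjK.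
  + by rewrite -szg gE deg_monicM // ?(smooth_monic Cb) ?(smooth_monic Cy).
  + by apply/smoothsP; rewrite size_conj; split=> //; apply: smooth_conj_unchosen.
  + exact/smoothsP.
Qed.

Lemma chosen_or_self_conj_convolution n :
  size (Y n) = (\sum_(i < n.+1) size (A i) * size (W (n - i)))%N.
Proof.
apply: (size_convolution (m := fun a w => a * w)) => //.
- exact: smooths_uniq.
- exact: smooths_uniq.
- exact: smooths_uniq.
- by move=> i j a /smoothsP[_ <-] /smoothsP[_ <-].
- move=> i j a w /smoothsP[Ca <-] /smoothsP[Cw <-]; apply/smoothsP.
  rewrite deg_monicM ?(smooth_monic Ca) ?(smooth_monic Cw) //; split=> //.
  by apply: smoothM; [apply: smooth_imp Ca; left|apply: smooth_imp Cw; right].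
- move=> i j i' j' a w a' w' /smoothsP[Ca _] /smoothsP[Cw _].
  move=> /smoothsP[Ca' _] /smoothsP[Cw' _].
  have disj Q : chosen Q -> self_conj Q -> False.
    by move=> cQ rQ; apply: (chosen_disj cQ); right.
  exact: (smooth_inj disj).
- move=> k g /smoothsP[/smooth_split[a [w [Ca Cw gE]]] szg].
  exists (size a).-1, (size w).-1, a, w; split=> //; try exact/smoothsP.
  by rewrite -szg gE deg_monicM // ?(smooth_monic Ca) ?(smooth_monic Cw).
Qed.

(* Used with [k = 1] for self-conjugate polynomials and [k = 2] for norms. *)
Lemma split_conj_inj a w a' w' : smooth chosen a -> smooth self_conj w ->
    smooth chosen a' -> smooth self_conj w' -> forall k,
  a * conj a * w ^+ k = a' * conj a' * w' ^+ k -> a = a' /\ w ^+ k = w' ^+ k.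
Proof.
have rest b v k : smooth chosen b -> smooth self_conj v ->
    smooth (fun Q => unchosen Q \/ self_conj Q) (conj b * v ^+ k).
  move=> Cb Cv; apply: smoothM.
    by apply: smooth_imp (smooth_conj_chosen Cb); left.
  elim: k => [|k IH]; first exact: smooth1.
  by rewrite exprS; apply: smoothM => //; apply: smooth_imp Cv; right.
move=> Ca Cw Ca' Cw' k; rewrite -!mulrA => E.
(* The chosen primes on the two sides make up exactly a and a', as the other factors contain
   none. *)
have [eqa] := smooth_inj chosen_disj Ca (rest _ _ k Ca Cw) Ca' (rest _ _ k Ca' Cw') E.
rewrite -eqa => /mulfI -> //; exact/monic_neq0/conj_monic/(smooth_monic Ca).
Qed.

Definition self_conj_monics n := [seq p <- monics n.*2 | conj p == p].

(** A fixed g contains Q and conj(Q) equally often, so its non-self-conjugate primes group into a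
    conj(a), and the remaining w has even degree. *)
Lemma self_conj_monics_convolution n :
  size (self_conj_monics n) = (\sum_(i < n.+1) size (A i) * size (W (n - i).*2))%N.
Proof.
apply: (size_convolution (B := fun j => W j.*2) (m := fun a w => a * conj a * w)) => //.
- exact: smooths_uniq.
- by move=> i; apply: smooths_uniq.
- by move=> i; rewrite filter_uniq // monics_uniq.
- by move=> i j a /smoothsP[_ <-] /smoothsP[_ <-].
- move=> i j a w /smoothsP[/smooth_monic ma <-] /smoothsP[Cw szw].
  have mw := smooth_monic Cw.
  have maa : a * conj a \is monic by rewrite monicMl ?conj_monic.
  rewrite mem_filter mem_monics monicMl ?mw // !deg_monicM ?conj_monic //.
  rewrite size_conj szw addnn doubleD eqxx andbT.
  by rewrite !conjM ?conj_monic // conjK (smooth_fixed Cw) [conj a * a]mulrC eqxx.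
- move=> i j i' j' a w a' w' /smoothsP[Ca _] /smoothsP[Cw _].
  move=> /smoothsP[Ca' _] /smoothsP[Cw' _].
  exact: (@split_conj_inj _ _ _ _ Ca Cw Ca' Cw' 1).
- move=> k g; rewrite mem_filter mem_monics => /and3P[/eqP fg mg /eqP szg].
  have /smooth_split[b [y [Cb /smooth_split[a [w [Ca Cw yE]]] gE]]] :
      smooth (fun Q => unchosen Q \/ chosen_or_self_conj Q) g.
    by split=> // Q _ _; apply: chosen_cases.
  have [[mb ma] mw] := (smooth_monic Cb, smooth_monic Ca, smooth_monic Cw).
  (* Conjugating g = b a w, with g and w fixed, and comparing chosen primes yields conj(b) = a. *)
  have E : conj b * (conj a * w) = a * (b * w).
    rewrite -[in LHS](smooth_fixed Cw) -!conjM ?monicMl // -yE -gE fg gE yE.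
    by rewrite mulrCA.
  have [||eqb _] := smooth_inj chosen_disj (smooth_conj_unchosen Cb) _ Ca _ E.
  + apply: smoothM; first by apply: smooth_imp (smooth_conj_chosen Ca); left.
    by apply: smooth_imp Cw; right.
  + by apply: smoothM; [apply: smooth_imp Cb; left|apply: smooth_imp Cw; right].
  have {}gE : g = a * conj a * w by rewrite gE yE -eqb conjK mulrCA mulrA.
  move: szg; rewrite {1}gE !deg_monicM ?monicMl ?conj_monic // size_conj => szg.
  have [szk szw] : ((size a).-1 + (k - (size a).-1) = k /\
      (size w).-1 = (k - (size a).-1).*2)%N.
    by move: szg; move: (size a).-1 (size w).-1 => da dw; lia.
  exists (size a).-1, (k - (size a).-1)%N, a, w; split=> //.
  + exact/smoothsP.
  + exact/smoothsP.
Qed.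

Hypothesis odd_F : odd #|F|.

(** Lagrange in the additive group gives q * 1 = 0, whereas 2 = 0 with q odd would give q * 1 =
    1. *)
Lemma two_neq0 : (2%:R : F) != 0.
Proof.
apply/eqP => two0.
have := expg_cardG (in_setT (1 : F)); rewrite cardsT FinRing.zmodXgE.
rewrite -(odd_double_half #|F|) odd_F -mul2n natrD natrM two0 mul0r addr0.
by move/eqP; rewrite oner_eq0.
Qed.

(** In even degree [conj] is the substitution of -S for S, whose fixed polynomials are the p(S^2)
    since 2 is invertible. *)
Lemma self_conj_monics_card n : size (self_conj_monics n) = (#|F| ^ n)%N.
Proof.
rewrite -size_monics.
have inj : injective (fun p : {poly F} => p \Po 'X^2).
  move=> p p' /eqP; rewrite -subr_eq0 -comp_polyB comp_poly_eq0 ?size_polyXn //.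
  by rewrite subr_eq0 => /eqP.
rewrite -(size_map (fun p : {poly F} => p \Po 'X^2)); apply/perm_size/uniq_perm.
- by rewrite filter_uniq // monics_uniq.
- by rewrite map_inj_uniq ?monics_uniq.
move=> g; rewrite mem_filter mem_monics; apply/and3P/mapP.
  move=> [/eqP fg mg /eqP szg].
  have gE : g = even_poly g \Po 'X^2.
    have := comp_oppX_conj g; rewrite szg fg -muln2 exprM sqrr_sign scale1r.
    rewrite comp_oppX_even_odd => E.
    have E2 : g + g = (even_poly g \Po 'X^2) + (even_poly g \Po 'X^2).
      rewrite -[X in X + _ = _]E -[X in _ + X = _](poly_even_odd g); ring.
    apply/eqP; rewrite -subr_eq0; have /eqP : 2%:R *: (g - (even_poly g \Po 'X^2)) = 0.
      by rewrite scaler_nat mulr2n addrACA E2 -opprD subrr.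
    by rewrite scaler_eq0 (negPf two_neq0).
  exists (even_poly g) => //; rewrite mem_monics; apply/andP; split.
    move: mg; rewrite !monicE {1}gE lead_coef_comp ?size_polyXn //.
    by rewrite lead_coefXn expr1n mulr1.
  by move/eqP: szg; rewrite {1}gE size_comp_poly size_polyXn /= -muln2 eqn_pmul2r.
move=> [p]; rewrite mem_monics => /andP[mp /eqP szp] ->.
have szg : (size (p \Po 'X^2)).-1 = n.*2.
  by rewrite size_comp_poly size_polyXn szp /= muln2.
split; last by rewrite szg.
  rewrite /conj szg -muln2 exprM sqrr_sign scale1r -comp_polyA comp_Xn_poly.
  by rewrite sqrrN.
by rewrite monicE lead_coef_comp ?size_polyXn // (monicP mp) lead_coefXn expr1n mulr1.
Qed.

(** A fixed polynomial of odd degree satisfies w(-S) = -w(S), hence vanishes at 0 in odd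
    characteristic; the prime S is itself self-conjugate. *)
Lemma self_conj_even n : size (W n.*2.+1) = size (W n.*2).
Proof.
have mX : ('X : {poly F}) \is monic := monicX F.
rewrite -(size_map ( *%R 'X) (W n.*2)); apply/perm_size/uniq_perm.
- exact: smooths_uniq.
- rewrite map_inj_uniq ?smooths_uniq //.
  by apply: mulfI; rewrite polyX_eq0.
move=> w; apply/smoothsP/mapP => [[Cw szw]|[v /smoothsP[Cv szv] ->]].
  have w0 : root w 0.
    have := congr1 (horner^~ 0) (comp_oppX_conj w).
    rewrite (smooth_fixed Cw) szw horner_comp !hornerE oppr0 exprS -muln2 exprM.
    rewrite sqrr_sign mulr1 mulN1r => /eqP; rewrite -addr_eq0 -mulr2n -mulr_natl.
    by rewrite mulf_eq0 (negPf two_neq0).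
  have Xw : 'X %| w by rewrite -['X]subr0 dvdp_XsubCl.
  have wE : w = 'X * (w %/ 'X) by rewrite mulrC divpK.
  have mv : w %/ 'X \is monic.
    by rewrite -(monicMr _ mX) divpK //; apply: smooth_monic Cw.
  exists (w %/ 'X) => //; apply/smoothsP; split.
    by apply: smooth_dvd Cw => //; apply: divp_dvd.
  by move: szw; rewrite wE deg_monicM // size_polyX add1n -wE => -[].
split.
  apply: smoothM => //; apply: smooth_irr; last exact: conjX.
  by split=> //; have := irredp_XsubC (0 : F); rewrite subr0.
by rewrite deg_monicM ?(smooth_monic Cv) // size_polyX szv.
Qed.

(** The norm of y at -S^2 equals (-1)^n y conj(y); the leading coefficient of (-S^2)^n cancels the
    sign. *)
Lemma half_norm_monics n y : y \in monics n -> half_norm y \in monics n.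
Proof.
rewrite !mem_monics => /andP[my /eqP szy].
have mcy := conj_monic my; have E := comp_half_norm y.
rewrite comp_oppX_conj szy -scalerAr in E.
have szh : (size (half_norm y)).-1 = n.
  have := congr1 (fun p : {poly F} => (size p).-1) E.
  rewrite size_comp_poly size_oppX2 size_scale ?signr_eq0 // deg_monicM // size_conj.
  by rewrite szy addnn -muln2 => /eqP; rewrite eqn_pmul2r // => /eqP.
rewrite szh eqxx andbT monicE.
have := congr1 lead_coef E; rewrite lead_coef_comp ?size_oppX2 // lead_coefZ szh.
rewrite lead_coefN lead_coefXn (monicP (_ : y * conj y \is monic)) ?monicMl //.
by rewrite mulr1 -[RHS]mul1r => /mulIf ->; rewrite ?signr_eq0.
Qed.

(** Equal norms give equal y conj(y) = a conj(a) w^2. This determines a and w^2, and monicity fixes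
    the sign of w. *)
Lemma half_norm_inj n : {in Y n &, injective (@half_norm F)}.
Proof.
move=> y y' /smoothsP[Cy szy] /smoothsP[Cy' szy'] E.
have [a [w [Ca Cw yE]]] := smooth_split Cy.
have [a' [w' [Ca' Cw' yE']]] := smooth_split Cy'.
have Ey : y * conj y = y' * conj y'.
  apply: (@scalerI _ _ ((-1) ^+ n)); first by rewrite signr_eq0.
  rewrite !scalerAr -{1}szy -szy' -!comp_oppX_conj -!comp_half_norm E //.
have conjE (b v : {poly F}) : smooth chosen b -> smooth self_conj v ->
    b * v * conj (b * v) = b * conj b * v ^+ 2.
  move=> Cb Cv; rewrite conjM ?(smooth_monic Cb) ?(smooth_monic Cv) //.
  by rewrite (smooth_fixed Cv); ring.
rewrite yE yE' !conjE // in Ey.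
have [eqa /eqP] := split_conj_inj Ca Cw Ca' Cw' Ey.
have mw := smooth_monic Cw; have mw' := smooth_monic Cw'.
rewrite yE yE' eqa eqf_sqr => /orP[/eqP -> //|/eqP wN].
have := congr1 lead_coef wN; rewrite lead_coefN (monicP mw) (monicP mw') => N1.
by rewrite wN -[- w']mulN1r -[-1]/(- 1%:P) -polyCN -N1 mul1r.
Qed.

(** A^2 + T B^2 is the norm of A(-S^2) + S B(-S^2); exchanging the unchosen factor b for conj(b)
    keeps the norm and lands in Y. *)
Lemma sum_form_half_norm n f : f \in monics n -> sum_form f ->
  exists2 y, y \in Y n & f = half_norm y.
Proof.
rewrite mem_monics => /andP[mf /eqP szf] [A0 [B0 fE]].
pose g0 := (A0 \Po - 'X^2) + 'X * (B0 \Po - 'X^2).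
have X2 : (- 'X^2 : {poly F}) \Po - 'X = - 'X^2.
  by rewrite rmorphN /= comp_Xn_poly sqrrN.
have g0E : g0 * (g0 \Po - 'X) = f \Po - 'X^2.
  rewrite /g0 fE !expr2 !comp_polyD !comp_polyM -!comp_polyA X2 !comp_polyX.
  rewrite -!expr2; ring.
have g00 : g0 != 0.
  apply: contraTneq mf => g00; move: g0E; rewrite g00 mul0r => /esym/eqP.
  rewrite comp_poly_eq0 ?size_oppX2 // => /eqP ->.
  by rewrite monicE lead_coef0 eq_sym oner_eq0.
have szg0 : (size g0).-1 = n.
  have := congr1 (fun p : {poly F} => (size p).-1) g0E.
  rewrite size_comp_poly size_oppX2 szf size_mul ?comp_poly2_eq0 ?size_oppX //.
  rewrite size_comp_poly2 ?size_oppX // (polySpred g00) addnS /=.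
  by rewrite addnn -muln2 => /eqP; rewrite eqn_pmul2r // => /eqP.
have lc2 : lead_coef g0 ^+ 2 = 1.
  have := congr1 lead_coef g0E.
  rewrite lead_coefM !lead_coef_comp ?size_oppX ?size_oppX2 //.
  rewrite szf szg0 (monicP mf) !lead_coefN lead_coefX lead_coefXn mulrA -expr2.
  by move/mulIf; apply; rewrite signr_eq0.
(* The leading coefficient squares to 1, so this scaling makes [g0] monic without changing its
   norm. *)
pose g := lead_coef g0 *: g0.
have gE : g * (g \Po - 'X) = f \Po - 'X^2.
  by rewrite /g comp_polyZ -scalerAl -scalerAr scalerA -expr2 lc2 scale1r.
have mg : g \is monic by rewrite monicE lead_coefZ -expr2 lc2.
have szg : (size g).-1 = n by rewrite size_scale ?lead_coef_eq0.
have /smooth_split[b [y [Cb Cy gby]]] :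
    smooth (fun Q => unchosen Q \/ chosen_or_self_conj Q) g.
  by split=> // Q _ _; apply: chosen_cases.
have mb := smooth_monic Cb; have my := smooth_monic Cy; have mcb := conj_monic mb.
have szby : (size (conj b * y)).-1 = n.
  by rewrite deg_monicM // size_conj -deg_monicM // -gby.
exists (conj b * y).
  apply/smoothsP; split=> //; apply: smoothM => //.
  by apply: smooth_imp (smooth_conj_unchosen Cb); left.
apply: (@comp_oppX2_inj F) => /=; rewrite comp_half_norm -gE !comp_oppX_conj.
rewrite szg szby gby !conjM // conjK -[LHS]scalerAr -[RHS]scalerAr.
congr (_ *: _); ring.
Qed.

Lemma Bq_smooths n : Bq F n = size (Y n).
Proof.
have -> : Bq F n = size [seq f <- monics n | `[< sum_form f >]].
  rewrite size_filter count_map -sum1_count big_enum_cond /= big_mkcond /=.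
  apply: eq_bigr => t _; rewrite /bq.
  by case: ClassicalEpsilon.excluded_middle_informative => H; case: asboolP.
rewrite -(size_map (@half_norm F)); apply/perm_size/uniq_perm.
- by rewrite filter_uniq // monics_uniq.
- by rewrite map_inj_in_uniq ?smooths_uniq //; apply: half_norm_inj.
move=> f; rewrite mem_filter; apply/andP/mapP => [[/asboolP sf mf]|[y Yy ->]].
  by have [y Yy ->] := sum_form_half_norm mf sf; exists y.
split; last by apply: half_norm_monics; move: Yy; rewrite mem_filter => /andP[].
apply/asboolP; exists (even_poly y \Po - 'X), (odd_poly y \Po - 'X).
exact: erefl.
Qed.

End Counting.

(** * The expansion of B_q(n) and the bounds *)

Section FunctionalEquation.
Variable F : finFieldType.
Hypothesis odd_F : odd #|F|.
Let q : rat := #|F|%:R.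

Definition Bseries : fps rat := fun n => (Bq F n)%:R.

Lemma smooths0 : size (smooths (@chosen F) 0) = 1%N /\ Bq F 0 = 1%N.
Proof.
have := monics_convolution F 0; rewrite big_ord1 expn0 subnn Bq_smooths //.
by move/esym/eqP; rewrite muln_eq1 => /andP[/eqP -> /eqP ->].
Qed.

Lemma Bseries0 : Bseries 0%N = 1.
Proof. by rewrite /Bseries smooths0.2. Qed.

Lemma Bseries_sq :
  (1 - fps_const q * fpsX rat) * Bseries ^+ 2 = (1 + fpsX rat) * fps_sq Bseries.
Proof.
pose A : fps rat := fun n => (size (smooths (@chosen F) n))%:R.
pose W : fps rat := fun n => (size (smooths (@self_conj F) n))%:R.
pose W2 : fps rat := fun n => W n.*2.
pose Z : fps rat := fun n => q ^+ n.
have ZAB : Z = A * Bseries.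
  apply: fpsP => n; rewrite /Z /q -natrX monics_convolution natr_sum fpsME.
  by apply: eq_bigr => i _; rewrite natrM /Bseries Bq_smooths.
have ZAW2 : Z = A * W2.
  apply: fpsP => n; rewrite /Z /q -natrX -(self_conj_monics_card odd_F).
  by rewrite self_conj_monics_convolution natr_sum fpsME; apply: eq_bigr => i _; rewrite natrM.
have BAW : Bseries = A * W.
  apply: fpsP => n; rewrite /Bseries Bq_smooths // chosen_or_self_conj_convolution.
  by rewrite natr_sum fpsME; apply: eq_bigr => i _; rewrite natrM.
(* Multiplied by A, both series give Z = 1/(1 - qu), and A cancels as its constant term is 1. *)
have BW2 : Bseries = W2.
  apply/eqP; rewrite -subr_eq0; apply/eqP; apply: (@fps_mulIl A).
    by rewrite /A smooths0.1.
  by rewrite mulrBr -ZAB ZAW2 subrr.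
have WE : W = (1 + fpsX rat) * fps_sq W2.
  apply: fpsP => -[|n]; rewrite mulrDl mul1r fpsDE.
    by rewrite fpsXM0 addr0 /fps_sq.
  rewrite fpsXMS /fps_sq /W2 /=; have [on|en] := boolP (odd n).
    by rewrite /= addr0 -[in LHS](odd_double_half n) on uphalf_half on.
  rewrite add0r /W -[in LHS](odd_double_half n) (negPf en) add0n.
  by rewrite self_conj_even.
have Z1 : (1 - fps_const q * fpsX rat) * Z = 1.
  apply: fpsP => -[|n]; first by rewrite fps_one_minus0.
  by rewrite fps_one_minusS fps1E /Z exprS subrr.
rewrite BW2 -WE -BW2 expr2 {2}BAW.
have -> : (1 - fps_const q * fpsX rat) * (Bseries * (A * W)) =
  (1 - fps_const q * fpsX rat) * (A * Bseries) * W by ring.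
by rewrite -ZAB Z1 mul1r.
Qed.

End FunctionalEquation.

(** * Recurrences for the weights h_m *)

Section CentralBinomial.

Lemma hh0 : hh 0 = 1.
Proof. exact: divr1. Qed.

Lemma hhS m : m.+1%:R * hh m.+1 = (m%:R + 2%:R^-1) * hh m.
Proof.
have C1 : (m.+1 * 'C(2 * m.+1, m.+1) = 2 * (2 * m + 1) * 'C(2 * m, m))%N.
  have E1 := mul_bin_diag (2 * m).+2 m; have E2 := mul_bin_down (2 * m).+1 m.
  rewrite /= in E1 E2; have -> : (2 * m.+1 = (2 * m).+2)%N by lia.
  rewrite (_ : (2 * m).+1 - m = m.+1)%N in E2; last lia.
  move: E1 E2; move: 'C((2 * m).+2, _) 'C((2 * m).+1, _) 'C(2 * m, _) => x y z; nia.
have := congr1 (fun x : nat => x%:R : rat) C1.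
rewrite /hh expnS !natrM natrD natrM natrX => E.
rewrite invfM [_ * (_^-1 * _)]mulrA.
have -> : m.+1%:R * ('C(2 * m.+1, m.+1)%:R * 4%:R^-1 * (4%:R ^+ m)^-1) =
   (m.+1%:R * 'C(2 * m.+1, m.+1)%:R) * (4%:R^-1 * (4%:R ^+ m)^-1) :> rat by ring.
rewrite E; field.
by rewrite expf_neq0.
Qed.

(** Telescoping [hhS]; this is the coefficient form of uP' = u/(2(1 - u)) P for P = (1 -
    u)^(-1/2). *)
Lemma sum_hh m : m%:R * hh m = 2%:R^-1 * \sum_(k < m) hh k.
Proof.
elim: m => [|m IH]; first by rewrite big_ord0 mulr0 mul0r.
by rewrite hhS mulrDl IH big_ord_recr /= mulrDr.
Qed.

End CentralBinomial.

(** * The universal polynomials D_n and G_n in q *)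

Section Recurrences.

(** Coefficients of D = uG'/G. Removing q^n/2, the share of P, from the recurrence for uB'/B leaves
    in degree 2m the term q^m/2, which comes from the share of P at u^2. *)
Definition log_coefs (D : nat -> {poly rat}) : Prop :=
  D 0%N = 0 /\ forall n, D n.+1 = ((-1) ^+ n / 2%:R)%:P +
    (if odd n.+1 then 0 else 2%:R^-1 *: 'X^(n.+1./2) + D n.+1./2).

Definition exp_coefs (D G : nat -> {poly rat}) : Prop :=
  G 0%N = 1 /\ forall n, n.+1%:R *: G n.+1 = \sum_(i < n.+1) D i.+1 * G (n - i)%N.

Lemma log_coefs_ex : exists D, log_coefs D.
Proof.
have [|D DE] := strong_rec 0 (Phi := fun n (D : nat -> {poly rat}) =>
  if n is m.+1 then ((-1) ^+ m / 2%:R)%:P +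
    (if odd n then 0 else 2%:R^-1 *: 'X^(n./2) + D n./2) else 0).
  move=> [|n] f g H //; rewrite H //; lia.
by exists D; split=> [|n]; rewrite DE.
Qed.

Lemma exp_coefs_ex D : exists G, exp_coefs D G.
Proof.
have [|G GE] := strong_rec 0 (Phi := fun n (G : nat -> {poly rat}) =>
  if n is m.+1 then n%:R^-1 *: \sum_(i < m.+1) D i.+1 * G (m - i)%N else 1).
  move=> [|n] f g H //; congr (_ *: _); apply: eq_bigr => i _.
  by rewrite H // ltnS leq_subr.
exists G; split=> [|n]; rewrite GE // scalerA mulfV ?scale1r //.
by rewrite pnatr_eq0.
Qed.

Variables D G : nat -> {poly rat}.
Hypothesis DE : log_coefs D.
Hypothesis GE : exp_coefs D G.

Lemma log_coefs_deg n c : (n < 2 * c)%N -> (D n)`_c = 0.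
Proof.
elim/ltn_ind: n c => -[|n] IH c ltnc; first by rewrite DE.1 coef0.
rewrite DE.2 coefD coefC; have -> : (c == 0)%N = false by lia.
rewrite add0r; case: ifP => odn; first by rewrite coef0.
rewrite coefD coefZ coefXn IH; [|lia..].
by have -> : (c == n.+1./2) = false by lia; rewrite mulr0 addr0.
Qed.

(** If 2c exceeds n + 1, any splitting c = j + (c - j) makes one factor of D_{i+1} G_{n-i} exceed
    its own degree bound. *)
Lemma exp_coefs_deg n c : (n < 2 * c)%N -> (G n)`_c = 0.
Proof.
elim/ltn_ind: n c => -[|n] IH c ltnc.
  by rewrite GE.1 coef1; case: c ltnc.
have /(congr1 (fun p : {poly rat} => p`_c)) := GE.2 n.
rewrite coefZ coef_sum big1 => [/eqP|i _]; first by rewrite mulf_eq0 pnatr_eq0 => /eqP.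
rewrite coefM big1 // => j _; have [ij|ij] := ltnP i.+1 (2 * j).
  by rewrite log_coefs_deg ?mul0r.
rewrite IH ?mulr0 //; first by rewrite ltnS leq_subr.
by have := ltn_ord i; have := ltn_ord j; lia.
Qed.

(** B and P G both solve [theta f = E * f] with constant term 1, so [fps_theta_eq0] applied to their
    difference identifies them. *)
Lemma Bq_expansion (F : finFieldType) (n : nat) (q := #|F|%:R : rat) : odd #|F| ->
  (Bq F n)%:R = \sum_(m < n.+1) hh m * q ^+ m * (G (n - m)%N).[q].
Proof.
move=> odd_F.
(* Q is uP'/P for P = (1 - qu)^(-1/2). *)
pose Q : fps rat := fun n => if n is _.+1 then q ^+ n / 2%:R else 0.
pose P : fps rat := fun n => hh n * q ^+ n.
pose Dq : fps rat := fun n => (D n).[q].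
pose Gq : fps rat := fun n => (G n).[q].
have PE : theta P = Q * P.
  apply: fpsP => k; rewrite fpsME big_ord_recl mul0r add0r /theta /P mulrA sum_hh.
  rewrite -mulrA mulrC mulr_suml (reindex_inj rev_ord_inj) /= mulr_suml.
  apply: eq_bigr => i _; rewrite /Q /bump /= add1n.
  have -> : q ^+ k = q ^+ i.+1 * q ^+ (k - i.+1) by rewrite -exprD subnKC.
  move: ('C(_, _)%:R / _) => h; by field.
have GqE : theta Gq = Dq * Gq.
  apply: fpsP => -[|k]; first by rewrite fpsM0E /theta /Dq DE.1 horner0 !mul0r.
  rewrite fpsME big_ord_recl {1}/Dq DE.1 horner0 mul0r add0r /theta /Gq -hornerZ.
  rewrite GE.2 horner_sum; apply: eq_bigr => i _.
  by rewrite hornerM /bump /= subSS.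
pose E := Q + Dq.
have EB : theta (Bseries F) = E * Bseries F.
  apply: (fps_log_derivative (q := q)).
  - exact: Bseries0.
  - exact: Bseries_sq.
  - by rewrite /E fpsDE /Q /Dq DE.1 horner0 addr0.
  move=> k; rewrite {1}/E fpsDE {1}/Q {1}/Dq DE.2 hornerD hornerC /fps_sq addrA.
  case: ifP => ok; rewrite ?horner0 // hornerD hornerZ hornerXn /E fpsDE /Q /Dq.
  have [j ->] : exists j, k.+1./2 = j.+1 by exists (k.+1./2).-1; lia.
  by ring.
suff BE : Bseries F = P * Gq by rewrite -[LHS]/(Bseries F n) BE.
apply/eqP; rewrite -subr_eq0; apply/eqP; apply: (@fps_theta_eq0 E).
- by rewrite /E fpsDE /Q /Dq DE.1 horner0 addr0.
- have thetaN (f : fps rat) : theta (- f) = - theta f.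
    by apply: fpsP => k; rewrite /theta !fpsNE mulrN.
  rewrite thetaD thetaN EB thetaM PE GqE /E; ring.
- rewrite fpsDE fpsNE Bseries0 // fpsM0E /P /Gq GE.1 hornerC.
  by rewrite hh0 expr0 !mulr1 subrr.
Qed.

End Recurrences.

(** * Weighted coefficient norms and growth *)

Section Bounds.

(** In the application t = 11/10, tau = 21/20, z = 21/22: t is the weight of the norm and the growth
    rate of G, tau governs D, and z = tau/t < 1 makes the sum of k z^k converge. *)
Variables t tau z : rat.
Hypothesis t_ge1 : 1 <= t.
Hypothesis tau_ge1 : 1 <= tau.
Hypothesis t_le_tau2 : t <= tau ^+ 2.
Hypothesis tauE : tau = t * z.

Implicit Types p r : {poly rat}.

Definition abs_poly (p : {poly rat}) : {poly rat} := \poly_(i < size p) `|p`_i|.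
Definition nrm p : rat := (abs_poly p).[t].

Lemma coef_abs_poly p i : (abs_poly p)`_i = `|p`_i|.
Proof.
by rewrite coef_poly; case: ltnP => // le; rewrite nth_default // normr0.
Qed.

Lemma t_ge0 : 0 <= t. Proof. exact: le_trans t_ge1. Qed.

Lemma nrm_le p r : (forall i, `|p`_i| <= r`_i) -> nrm p <= r.[t].
Proof.
move=> le; rewrite /nrm (horner_coef_wide t (leq_maxl (size (abs_poly p)) (size r))).
rewrite (horner_coef_wide t (leq_maxr (size (abs_poly p)) (size r))).
apply: ler_sum => i _; rewrite coef_abs_poly ler_wpM2r //.
exact/exprn_ge0/t_ge0.
Qed.

Lemma nrm_ge0 p : 0 <= nrm p.
Proof.
rewrite /nrm horner_coef sumr_ge0 // => i _; rewrite coef_abs_poly mulr_ge0 //.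
exact/exprn_ge0/t_ge0.
Qed.

Lemma nrmD p r : nrm (p + r) <= nrm p + nrm r.
Proof.
rewrite -hornerD; apply: nrm_le => i.
by rewrite !coefD !coef_abs_poly ler_normD.
Qed.

Lemma nrm_sum n (p : nat -> {poly rat}) :
  nrm (\sum_(i < n) p i) <= \sum_(i < n) nrm (p i).
Proof.
elim: n => [|n IH]; last first.
  by rewrite !big_ord_recr /=; apply: le_trans (nrmD _ _) _; rewrite lerD2r.
by rewrite !big_ord0 -[leRHS](horner0 t); apply: nrm_le => i; rewrite coef0 normr0.
Qed.

Lemma nrmM p r : nrm (p * r) <= nrm p * nrm r.
Proof.
rewrite -hornerM; apply: nrm_le => i; rewrite !coefM.
apply: le_trans (ler_norm_sum _ _ _) _; apply: ler_sum => j _.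
by rewrite !coef_abs_poly normrM.
Qed.

Lemma nrmZ c p : nrm (c *: p) = `|c| * nrm p.
Proof.
rewrite -hornerZ; congr (_.[t]); apply/polyP => i.
by rewrite coefZ !coef_abs_poly coefZ normrM.
Qed.

Lemma nrmC c : nrm c%:P <= `|c|.
Proof.
rewrite -[leRHS](hornerC _ t); apply: nrm_le => i.
by rewrite !coefC; case: ifP; rewrite ?normr0.
Qed.

Lemma nrmXn n : nrm 'X^n <= t ^+ n.
Proof.
rewrite -[leRHS]hornerXn; apply: nrm_le => i.
by rewrite coefXn normr_nat.
Qed.

Lemma coef_le_nrm p i : `|p`_i| * t ^+ i <= nrm p.
Proof.
have [lti|ile] := ltnP i (size (abs_poly p)); last first.
  by rewrite -coef_abs_poly nth_default // mul0r nrm_ge0.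
rewrite /nrm horner_coef (bigD1 (Ordinal lti)) //= coef_abs_poly lerDl.
rewrite sumr_ge0 // => j _; rewrite coef_abs_poly mulr_ge0 //.
exact/exprn_ge0/t_ge0.
Qed.

(** In degree 2(m+1), t <= tau^2 bounds the term in q^(m+1) by tau^(2(m+1))/2. With the constant 1/2
    it is absorbed by one copy of (m+1) tau^(2(m+1)); induction supplies the other copy. *)
Lemma log_coefs_nrm D n : log_coefs D -> nrm (D n) <= n%:R * tau ^+ n.
Proof.
move=> DE; elim/ltn_ind: n => -[|n] IH.
  rewrite DE.1 mul0r -(normr0 rat) -polyC0; exact: nrmC.
have tau1 k : 1 <= tau ^+ k := exprn_ege1 k tau_ge1.
have cle : nrm ((-1) ^+ n / 2%:R)%:P <= 2%:R^-1.
  by apply: le_trans (nrmC _) _; rewrite normrM normrX normrN1 expr1n mul1r.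
rewrite DE.2; apply: le_trans (nrmD _ _) _; case: ifP => odn.
  rewrite -polyC0 (le_trans (lerD cle (nrmC _))) // normr0 addr0.
  apply: (@le_trans _ _ 1); first by lra.
  by rewrite mulr_ege1 // ler1n.
have [m mE] : exists m, n.+1 = m.+1.*2 by exists (n.+1./2).-1; lia.
have -> : n.+1./2 = m.+1 by lia.
have IHm := IH m.+1 ltac:(lia).
have tm : t ^+ m.+1 <= tau ^+ n.+1.
  rewrite mE -muln2 mulnC exprM lerXn2r // nnegrE; first exact: t_ge0.
  exact: le_trans t_ge0 t_le_tau2.
have taum : tau ^+ m.+1 <= tau ^+ n.+1.
  by apply: ler_weXn2l tau_ge1 _ _ _; lia.
have X1 : nrm (2%:R^-1 *: 'X^(m.+1)) <= 2%:R^-1 * tau ^+ n.+1.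
  rewrite nrmZ ger0_norm // ler_wpM2l //.
  exact: le_trans (nrmXn _) tm.
apply: le_trans (lerD cle (le_trans (nrmD _ _) (lerD X1 IHm))) _.
have le1 := tau1 n.+1.
have le2 : m.+1%:R * tau ^+ m.+1 <= m.+1%:R * tau ^+ n.+1 by rewrite ler_wpM2l.
have le3 : tau ^+ n.+1 <= m.+1%:R * tau ^+ n.+1.
  by rewrite -[leLHS]mul1r ler_wpM2r ?ler1n //; apply: le_trans le1.
have -> : n.+1%:R = m.+1%:R + m.+1%:R :> rat by rewrite mE -addnn natrD.
rewrite mulrDl; lra.
Qed.

(* [n ||G_n|| <= sum_k ||D_k|| ||G_(n-k)||] with [sum_k ||D_k|| / t^k <= M]:
   from [n = M] on the bound propagates with the same constant. *)
Lemma exp_coefs_nrm D G (M : nat) : log_coefs D -> exp_coefs D G ->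
    (forall n, \sum_(k < n) k%:R * z ^+ k <= M%:R) ->
  exists2 K : rat, 0 <= K & forall n, nrm (G n) <= K * t ^+ n.
Proof.
(* K dominates every norm up to index M, which starts the induction. *)
move=> DE GE sumz; pose K := \sum_(m < M.+1) nrm (G m).
have K0 : 0 <= K by rewrite sumr_ge0 // => i _; apply: nrm_ge0.
exists K => // n; elim/ltn_ind: n => n IH.
have [ltn|] := ltnP n M.+1.
  apply: (@le_trans _ _ K).
    rewrite /K (bigD1 (Ordinal ltn)) //= lerDl sumr_ge0 // => i _.
    exact: nrm_ge0.
  by rewrite ler_peMr // exprn_ege1.
case: n IH => // n IH len.
have n0 : (0 : rat) < n.+1%:R by rewrite ltr0n.
rewrite -(ler_pM2l n0) -[X in X * nrm _](ger0_norm (ltW n0)) -nrmZ GE.2.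
apply: le_trans (nrm_sum _ (fun i => D i.+1 * G (n - i)%N)) _.
have step i : (i < n.+1)%N ->
    nrm (D i.+1 * G (n - i)%N) <= K * t ^+ n.+1 * (i.+1%:R * z ^+ i.+1).
  move=> lin; apply: le_trans (nrmM _ _) _.
  have GI : nrm (G (n - i)%N) <= K * t ^+ (n - i) by apply: IH; rewrite ltnS leq_subr.
  apply: le_trans (ler_pM (nrm_ge0 _) (nrm_ge0 _) (log_coefs_nrm _ DE) GI) _.
  have -> : t ^+ n.+1 = t ^+ i.+1 * t ^+ (n - i) by rewrite -exprD; congr (_ ^+ _); lia.
  by rewrite tauE exprMn le_eqVlt; apply/orP; left; apply/eqP; ring.
apply: (@le_trans _ _ (\sum_(i < n.+1) K * t ^+ n.+1 * (i.+1%:R * z ^+ i.+1))).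
  by apply: ler_sum => i _; apply: step.
rewrite -mulr_sumr mulrC; apply: ler_wpM2r.
  by rewrite mulr_ge0 ?exprn_ge0 ?t_ge0.
have := sumz n.+2; rewrite big_ord_recl mul0r add0r => /le_trans; apply.
by rewrite ler_nat; lia.
Qed.

End Bounds.

(** Here a = 1/(1 - z), and b = z/(1 - z)^2 is the full series; the exact remainder (a n + b) z^n is
    nonnegative. *)
Lemma sum_natM_exp (z : rat) (a b n : nat) : 0 <= z ->
    a%:R * (1 - z) = 1 -> b%:R * (1 - z) = a%:R * z ->
  \sum_(k < n) k%:R * z ^+ k <= b%:R.
Proof.
move=> z0 aE bE.
suff -> : \sum_(k < n) k%:R * z ^+ k = b%:R - (a%:R * n%:R + b%:R) * z ^+ n.
  by rewrite gerBl mulr_ge0 ?exprn_ge0 // -natrM -natrD ler0n.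
elim: n => [|n IH]; first by rewrite big_ord0 expr0; ring.
rewrite big_ord_recr /= IH exprS -natr1.
have -> : (a%:R * (n%:R + 1) + b%:R) * (z * z ^+ n) =
    ((a%:R * n%:R + b%:R) - a%:R * (1 - z) * n%:R -
     (b%:R * (1 - z) - a%:R * z)) * z ^+ n by ring.
by rewrite aE bE subrr; ring.
Qed.

Lemma exp_coefs_bound D G : log_coefs D -> exp_coefs D G ->
  exists K : rat, forall j k, (k <= j)%N ->
    `|(G j)`_(j - k)| <= K * (11%:R / 10%:R) ^+ k.
Proof.
move=> DE GE; have : (1 : rat) <= 11%:R / 10%:R by lra.
have : (1 : rat) <= 21%:R / 20%:R by lra.
have : 11%:R / 10%:R <= (21%:R / 20%:R) ^+ 2 :> rat by rewrite expr2; lra.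
have : 21%:R / 20%:R = 11%:R / 10%:R * (21%:R / 22%:R) :> rat by lra.
have sumz n : \sum_(k < n) k%:R * (21%:R / 22%:R) ^+ k <= 462%:R :> rat.
  (* For z = 21/22, 1/(1 - z) = 22 and z/(1 - z)^2 = 21 * 22 = 462. *)
  by apply: (@sum_natM_exp _ 22); lra.
(* Abstracting the fractions keeps conversion from evaluating them. *)
move: (21%:R / 22%:R) (21%:R / 20%:R) (11%:R / 10%:R) 462%N sumz.
move=> z tau t M sumz tauE t_tau2 tau1 t1.
have [K K0 GK] := exp_coefs_nrm t1 tau1 t_tau2 tauE DE GE sumz.
exists K => j k lekj.
(* Multiplied by t^(j-k), the coefficient is at most the norm of G_j, hence at most K t^j; dividing
   back leaves t^k. *)
have t0 : 0 < t ^+ (j - k) by rewrite exprn_gt0 //; apply: lt_le_trans t1.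
rewrite -(ler_pM2r t0) -mulrA -exprD subnKC //.
exact: le_trans (coef_le_nrm t1 _ _) (GK j).
Qed.

Theorem theorem1 :
  exists (b : nat -> nat -> rat) (delta : nat -> nat -> nat -> rat) (C : rat),
    (* B_q(n) = sum_k b_{k,n} q^{n-k} for every odd prime power q *)
    (forall (n : nat), (2 <= n)%N ->
       forall F : finFieldType, odd #|F| ->
         (Bq F n)%:R = \sum_(k < n.+1) b k n * (#|F|%:R) ^+ (n - k)) /\
    (* (a) *)
    (forall (n k : nat), (2 <= n)%N -> (k <= n)%N ->
       b k n = \sum_(k <= j < (2 * k).+1) delta k j n * hh (n%:Z - j%:Z)) /\
    (* (b), stability *)
    (forall (k j n : nat), (2 <= n)%N -> (k <= j <= 2 * k)%N -> (2 * k <= n)%N ->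
       delta k j n = delta k j n.+1) /\
    (* (b), uniform bound *)
    (forall (k j n : nat), (2 <= n)%N -> (k <= j <= 2 * k)%N ->
       `|delta k j n| <= C * (11%:R / 10%:R) ^+ k).
Proof.
have [D DE] := log_coefs_ex; have [G GE] := exp_coefs_ex D.
have [K GK] := exp_coefs_bound DE GE.
(* The term h_{n-j} q^(n-j) G_j reaches q^(n-k) through the coefficient of q^(j-k) in G_j. No n
   occurs here, so stability is immediate. *)
pose delta k j (n : nat) := (G j)`_(j - k).
pose b k n := \sum_(k <= j < (2 * k).+1) delta k j n * hh (n%:Z - j%:Z).
exists b, delta, K; split; last first.
  by split=> //; split=> // k j n _ /andP[lekj _]; apply: GK.
move=> n _ F odd_F; rewrite (Bq_expansion DE GE) //; set q := #|F|%:R.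
(* Extension by zero to a square range lets the two summations be exchanged. *)
pose T j k := if (k <= j <= n)%N
  then (G j)`_(j - k) * hh (n%:Z - j%:Z) * q ^+ (n - k) else 0.
transitivity (\sum_(j < n.+1) \sum_(k < n.+1) T j k).
  rewrite (reindex_inj rev_ord_inj) /=; apply: eq_bigr => j _; rewrite subSS.
  have lejn : (j <= n)%N by rewrite -ltnS.
  have szG : (size (G j) <= j.+1)%N.
    by apply/leq_sizeP => c ltjc; apply: (exp_coefs_deg DE GE); lia.
  rewrite subKn // (horner_coef_wide _ szG) (reindex_inj rev_ord_inj) /= big_distrr /=.
  rewrite (big_ord_widen _ (fun k => hh (n - j)%N * q ^+ (n - j) *
    ((G j)`_(j.+1 - k.+1) * q ^+ (j.+1 - k.+1))) (ltn_ord j)) big_mkcond /=.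
  apply: eq_bigr => k _; rewrite /T ltnS lejn andbT; case: ifP => // lekj.
  rewrite subSS subzn // (_ : n - k = (n - j) + (j - k))%N; last lia.
  by rewrite -[_%:R / _]/(hh (n - j)%N) exprD; ring.
rewrite exchange_big /=; apply: eq_bigr => k _; rewrite /b big_geq_mkord mulr_suml.
have lekn : (k <= n)%N by rewrite -ltnS.
(* Either of n and 2k may be the larger, so both sums over j are padded to j <= 2n. *)
have w1 : (n.+1 <= (2 * n).+1)%N by lia.
have w2 : ((2 * k).+1 <= (2 * n).+1)%N by lia.
rewrite (big_ord_widen _ (fun j => T j k) w1).
rewrite (big_ord_widen_cond _ (fun j => (k <= j)%N)
  (fun j => delta k j n * hh (n%:Z - j%:Z) * q ^+ (n - k)) w2).
rewrite big_mkcond [RHS]big_mkcond; apply: eq_bigr => j _ /=; rewrite /T /delta !ltnS.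
(* The terms with j > 2k vanish because G_j has degree at most j/2, those with j > n because h is
   zero at negative arguments. *)
have [lejn|ltnj] := leqP j n; rewrite ?andbT ?andbF.
  case: (leqP k j) => //= lekj; case: leqP => // lt2kj.
  by rewrite (exp_coefs_deg DE GE) ?mul0r //; lia.
case: ifP => // _; have -> : n%:Z - j%:Z = Negz (j - n).-1 by lia.
by rewrite mulr0 mul0r.
Qed.
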